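(* Let $k\ge 1$ be an integer and let $\mathcal{H}\subseteq FIN_k^{[\infty]}$ be a semiselective Gowers coideal of block sequences. Then the family of $\mathcal{H}$-Ramsey subsets of $FIN_k^{[\infty]}$ is closed under the Suslin operation: if $(\mathcal{X}_a)_{a\in FIN_k^{[<\infty]}}$ is a family of $\mathcal{H}$-Ramsey subsets of $FIN_k^{[\infty]}$, then $$\bigcup_{A\in FIN_k^{[\infty]}}\ \bigcap_{n\in\mathbb{N}}\mathcal{X}_{A\upharpoonright n}$$ is $\mathcal{H}$-Ramsey.
   Context: Block sequences. Let $\mathbb{N}=\{0,1,2,\dots\}$ and fix an integer $k\ge 1$. $FIN_k$ is the set of functions $p:\mathbb{N}\to\{0,1,\dots,k\}$ whose support $supp(p)=\{n: p(n)\ne 0\}$ is finite and whose image contains $k$. A block sequence is a finite (possibly empty) or infinite (indexed in order type $\mathbb{N}$) sequence of elements of $FIN_k$ such that $\max(supp(x))<\min(supp(y))$ whenever $x$ precedes $y$; it is identified with its set of terms. $FIN_k^{[\infty]}$, $FIN_k^{[<\infty]}$ and $FIN_k^{[n]}$ are the sets of infinite, finite, and length-$n$ block sequences; $|a|$ is the length of $a$. For $j\in\mathbb{N}$ put $T^{(j)}(p)(n)=\max\{p(n)-j,0\}$. For a finite or infinite block sequence $A=(a_n)_{n\in I}$, $[A]\subseteq FIN_k$ is the set of all functions $T^{(j_0)}(a_{n_0})+\cdots+T^{(j_r)}(a_{n_r})$ with $n_0<\cdots<n_r$ in $I$, $j_0,\dots,j_r\in\{0,1,\dots,k\}$ and $j_i=0$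 for at least one $i$. $A\le B$ means $A\subseteq[B]$. $A\upharpoonright n$ is the sequence of the first $n$ terms of $A$ ($A\upharpoonright 0=\emptyset$), and $a\sqsubset B$ means $a=B\upharpoonright n$ for some $n$. For a finite block sequence $a$, $supp(a)$ is the union of the supports of its terms; $a<b$ means $\max(supp(a))<\min(supp(b))$ (always true if $a=\emptyset$). $A/a=\{b\in A: a<b\}$. For $a\in FIN_k^{[<\infty]}$ and $A\in FIN_k^{[\infty]}$, $[a,A]=\{B\in FIN_k^{[\infty]}: a\sqsubset B \text{ and } B/a\subseteq[A]\}$; in particular $[\emptyset,A]=\{B\in FIN_k^{[\infty]}: B\le A\}$. Coideals. $\mathcal{H}\subseteq FIN_k^{[\infty]}$ is a coideal of block sequences if (i) $A\le B$ and $A\in\mathcal{H}$ (with $A,B\in FIN_k^{[\infty]}$) imply $B\in\mathcal{H}$; and (ii) for every $A\in\mathcal{H}$ and every partition $A=B\cup C$ there is $D\in\mathcal{H}$ with $D\le B$ or $D\le C$. Write $\mathcal{H}\upharpoonright A=\{B\in\mathcal{H}: B\le A\}$. $\mathcal{H}$ is Gowers if for every integer $r>0$, every $A\in\mathcal{H}$ and every $f:FIN_k\to\{0,\dots,r-1\}$ there is $B\in\mathcal{H}\upharpoonright A$ such that $f$ is constant on $[B]$. A set $\mathcal{D}\subseteq\mathcal{H}$ is dense open in $(\mathcal{H},\le)$ if $B\in\mathcal{D}$, $A\in\mathcal{H}$, $A\le B$ imply $A\in\mathcal{D}$, and for every $A\in\mathcal{H}$ there is $B\in\mathcal{D}$ with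 $B\le A$. If $(A_n)_{n\in\mathbb{N}}$ is a $\le$-decreasing sequence in $FIN_k^{[\infty]}$, then $B\in FIN_k^{[\infty]}$ is a diagonalization of $(A_n)_n$ if $B/b\le A_n$ for every $b\in[B]$, where $n=\max(supp(b))$. $\mathcal{H}$ is semiselective if for every $A\in\mathcal{H}$ and every sequence $(\mathcal{D}_n)_{n\in\mathbb{N}}$ of dense open subsets of $(\mathcal{H},\le)$ there are a $\le$-decreasing sequence $(A_n)_n$ with $A_n\in\mathcal{D}_n$ for all $n$ and some $B\in\mathcal{H}\upharpoonright A$ which is a diagonalization of $(A_n)_n$. $\mathcal{X}\subseteq FIN_k^{[\infty]}$ is $\mathcal{H}$-Ramsey if for all $A\in\mathcal{H}$ and $a\in FIN_k^{[<\infty]}$ there is $B\in[a,A]\cap\mathcal{H}$ with $[a,B]\subseteq\mathcal{X}$ or $[a,B]\cap\mathcal{X}=\emptyset$. *)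

(* Defs.v *)
From HB Require Import structures.
From mathcomp Require Import all_boot finmap.
From mathcomp Require Import boolp classical_sets.

Set Implicit Arguments.
Unset Strict Implicit.
Unset Printing Implicit Defensive.

Local Open Scope fset_scope.
Local Open Scope classical_set_scope.

(* Values on the empty set are irrelevant. *)
Definition fmax (S : {fset nat}) : nat := \max_(n <- S) n.
Definition fmin (S : {fset nat}) : nat := \big[minn/fmax S]_(n <- S) n.

(* max S < min S', with the convention that this holds when S is empty. *)
Definition supp_lt (S S' : {fset nat}) : bool :=
  (S == fset0) || (fmax S < fmin S').

Record FIN (k : nat) := MkFIN {
  FIN_val :> {fsfun nat -> 'I_k.+1 with ord0};
  _ : ord_max \in [fset FIN_val n | n in finsupp FIN_val] }.

HB.instance Definition _ k := [isSub for @FIN_val k].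
HB.instance Definition _ k := [Countable of FIN k by <:].

Definition supp k (p : FIN k) : {fset nat} := finsupp p.

Definition block_lt k : rel (FIN k) := [rel p q | supp_lt (supp p) (supp q)].

Record fblock (k : nat) := MkFblock {
  fblock_val :> seq (FIN k);
  _ : pairwise (@block_lt k) fblock_val }.

HB.instance Definition _ k := [isSub for @fblock_val k].
HB.instance Definition _ k := [Countable of fblock k by <:].

Definition fblock_supp k (a : fblock k) : {fset nat} :=
  \bigcup_(p <- a) supp p.

Record iblock (k : nat) := MkIblock {
  iblock_fun :> nat -> FIN k;
  iblockP : forall m n, m < n -> block_lt (iblock_fun m) (iblock_fun n) }.

Definition terms k (A : iblock k) : set (FIN k) := range A.

Lemma pairwise_restr k (A : iblock k) n : pairwise (@block_lt k) (mkseq A n).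
Proof.
rewrite /mkseq pairwise_map; apply: (sub_pairwise (r := ltn)).
  by move=> i j; exact: iblockP.
by rewrite -(sorted_pairwise ltn_trans) iota_ltn_sorted.
Qed.

Definition restr k (A : iblock k) (n : nat) : fblock k :=
  MkFblock (pairwise_restr A n).

Definition initial k (a : fblock k) (B : iblock k) : Prop :=
  exists n, a = restr B n.

Definition tetris k (j : nat) (p : FIN k) (n : nat) : nat := p n - j.

(* The set [A], where a finite or infinite block sequence A is given by its set
   of terms S: indexing by n_0 < ... < n_r amounts to listing terms in block
   order.  The list s consists of the pairs (a_(n_i), j_i). *)
Definition span k (S : set (FIN k)) : set (FIN k) :=
  [set p : FIN k | exists s : seq (FIN k * 'I_k.+1),
     [/\ pairwise (@block_lt k) (unzip1 s),
         (forall x, x \in s -> S x.1),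
         (exists2 x, x \in s & x.2 = ord0)
       & forall n, p n = \sum_(x <- s) tetris x.2 x.1 n :> nat]].

Definition block_le k (S S' : set (FIN k)) : Prop := S `<=` span S'.

Definition iblock_le k (A B : iblock k) : Prop := block_le (terms A) (terms B).

(* A/a is [after (fblock_supp a) A], and B/b is [after (supp b) B]. *)
Definition after k (S : {fset nat}) (A : iblock k) : set (FIN k) :=
  [set b | terms A b /\ supp_lt S (supp b)].

Definition basic k (a : fblock k) (A : iblock k) : set (iblock k) :=
  [set B | initial a B /\ after (fblock_supp a) B `<=` span (terms A)].

(* The two pieces of a partition of A may be finite or infinite block
   sequences, so they are given as sets of terms. *)
Definition coideal k (H : set (iblock k)) : Prop :=
  (forall A B, iblock_le A B -> H A -> H B) /\
  (forall A, H A -> forall B C : set (FIN k),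
     terms A = B `|` C -> B `&` C = set0 ->
     exists D, H D /\ (block_le (terms D) B \/ block_le (terms D) C)).

Definition Gowers k (H : set (iblock k)) : Prop :=
  forall (r : nat), 0 < r -> forall A, H A -> forall f : FIN k -> 'I_r,
    exists B, [/\ H B, iblock_le B A
      & exists c : 'I_r, forall p, span (terms B) p -> f p = c].

Definition dense_open k (H D : set (iblock k)) : Prop :=
  [/\ D `<=` H,
      (forall A B, D B -> H A -> iblock_le A B -> D A)
    & forall A, H A -> exists B, D B /\ iblock_le B A].

Definition decreasing k (As : nat -> iblock k) : Prop :=
  forall m n, m <= n -> iblock_le (As n) (As m).

Definition diagonalization k (As : nat -> iblock k) (B : iblock k) : Prop :=
  forall b, span (terms B) b ->
    block_le (after (supp b) B) (terms (As (fmax (supp b)))).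

Definition semiselective k (H : set (iblock k)) : Prop :=
  forall A, H A -> forall D : nat -> set (iblock k),
    (forall n, dense_open H (D n)) ->
    exists As : nat -> iblock k,
      [/\ decreasing As, (forall n, D n (As n))
        & exists B, [/\ H B, iblock_le B A & diagonalization As B]].

Definition Ramsey k (H X : set (iblock k)) : Prop :=
  forall A, H A -> forall a : fblock k,
    exists B, [/\ basic a A B, H B
      & basic a B `<=` X \/ basic a B `&` X = set0].

(* Main.v *)
(** Semiselectivity gives a fusion principle: any property of
    pairs (b, B) that is open and dense in B can be realised by a single B in H simultaneously for all finite b extending a
    within B.  Fusion and the Gowers property yield Galvin's dichotomy (every
    member of [[a, B]] has an initial segment in F, or none has), hence open
    sets and countable unions of Ramsey sets are Ramsey.
    For the Suslin operation write S_s for the part of the union whose witness A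
    extends s, and fuse to get B_0 which, for every b and the first |b| indices
    s, either satisfies [[b, B_0]] /\ S_s = 0 or has no member of H below it doing
    so.  The sets of C having no initial segment of the first kind are closed
    hulls of the S_s; the gap between the hull of s and the union of the hulls
    of its children is Ramsey and, within [[a, B_0]],
    disjoint from S_s, so by the choice of B_0 it
    can be avoided, and outside all gaps a point of the hull of the root
    determines a witnessing branch. *)
Require Import Defs.
From mathcomp Require Import all_boot finmap boolp classical_sets zify.

Set Implicit Arguments.
Unset Strict Implicit.
Unset Printing Implicit Defensive.

Local Open Scope classical_set_scope.

Section BlockSequences.

Variable k : nat.
Implicit Types (S : {fset nat}) (p q : FIN k) (a b s t : fblock k).
Implicit Types (A B C D : iblock k).

(** * Supports and the block order *)

Lemma mem_supp p n : (n \in supp p) = (0 < p n).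
Proof. by rewrite /supp mem_finsupp -val_eqE lt0n. Qed.

Lemma FIN_top p : exists2 n, n \in supp p & p n = k :> nat.
Proof.
by case: p => f fP; have /imfsetP [n /= nf E] := fP; exists n; rewrite // -E.
Qed.

Lemma FIN_le p n : p n <= k.
Proof. by rewrite -ltnS. Qed.

Lemma FIN_gt0 p : 0 < k.
Proof.
case: (FIN_top p) => n; rewrite mem_supp => h E; by rewrite -E.
Qed.

Lemma FIN_eq p q : (forall n, p n = q n :> nat) -> p = q.
Proof.
by move=> E; apply/val_inj/fsfunP => n; apply/val_inj; exact: E.
Qed.

Lemma leq_fmax S n : n \in S -> n <= fmax S.
Proof. by move=> nS; exact: leq_bigmax_seq. Qed.

Lemma supp_ltP S p :
  reflect (forall x y, x \in S -> y \in supp p -> x < y) (supp_lt S (supp p)).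
Proof.
have fmin_leq y : y \in supp p -> fmin (supp p) <= y.
  have fmin_seq (r : seq nat) m : y \in r -> \big[minn/m]_(n <- r) n <= y.
    elim: r => // z r IH; rewrite inE big_cons => /orP [/eqP ->|/IH].
      exact: geq_minl.
    by apply: leq_trans; exact: geq_minr.
  exact: fmin_seq.
apply: (iffP orP) => [[/eqP ->|h] x y //|h].
  by move=> /leq_fmax xS /fmin_leq yp; lia.
case: (eqVneq S fset0%fset) => [|S0]; [by left | right].
have [n np _] := FIN_top p.
have lt_S y : y \in supp p -> fmax S < y.
  (* As [S] has a point below [y], [y] is positive and [y.-1] bounds [S]; this turns the strict
     bound into the weak one that a maximum accepts. *)
  move=> yp; have y_gt0 : 0 < y.
    by case/fset0Pn: S0 => x xS; have := h _ _ xS yp; lia.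
  have: fmax S <= y.-1; last by lia.
  by apply/bigmax_leqP_seq => x xS _; have := h _ _ xS yp; lia.
(* The default value [fmax (supp p)] of the minimum also has to exceed [fmax S]; this is where a
   point [n] of [supp p] is needed. *)
rewrite /fmin big_seq; apply: (big_ind (fun m => fmax S < m)).
- by apply: leq_trans (lt_S _ np) (leq_fmax np).
- by move=> x y; rewrite leq_min => -> ->.
- by move=> i; exact: lt_S.
Qed.

Lemma block_ltP p q :
  reflect (forall x y, x \in supp p -> y \in supp q -> x < y) (block_lt p q).
Proof. exact: supp_ltP. Qed.

Lemma iblock_inj_supp A i j n : n \in supp (A i) -> n \in supp (A j) -> i = j.
Proof.
move=> ni nj; case: (ltngtP i j) => // /(@iblockP _ A) /block_ltP h.
  by have := h _ _ ni nj; rewrite ltnn.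
by have := h _ _ nj ni; rewrite ltnn.
Qed.

Lemma iblock_supp_ge A i n : n \in supp (A i) -> i <= n.
Proof.
elim: i n => // i IH n ni.
have [m mi _] := FIN_top (A i).
by apply: leq_ltn_trans (IH _ mi) _; move: mi ni; apply/block_ltP/iblockP.
Qed.

Lemma iblock_inj A : injective A.
Proof.
move=> i j E; have [n ni _] := FIN_top (A i).
by apply: (@iblock_inj_supp A i j n); rewrite -?E.
Qed.

(** * The span and its transitivity *)

(* A description of [A] that does not mention finite lists: [g i] is the
   exponent j of T^(j) applied to [A i], exponents >= k erasing the term. *)
Lemma spanP A p :
  span (terms A) p <->
  exists g : nat -> nat,
    [/\ exists i, g i = 0,
        forall i n, n \in supp (A i) -> p n = A i n - g i :> nat
      & forall n, (forall i, n \notin supp (A i)) -> p n = 0 :> nat].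
Proof.
split.
- case=> s [pw sA [x0 x0s x00] E].
  have [f fP] : exists f : FIN k -> nat, forall x, x \in s -> A (f x.1) = x.1.
    have /choice [f fP] : forall q : FIN k, exists i, terms A q -> A i = q.
      move=> q; case: (pselect (terms A q)) => [[i _ <-]|nq]; first by exists i.
      by exists 0.
    by exists f => x /sA /fP.
  have us : uniq (unzip1 s).
    apply: (pairwise_uniq _ pw) => x; apply/block_ltP => /= h.
    by have [n nx _] := FIN_top x; have := h _ _ nx nx; rewrite ltnn.
  have other x n i : x \in s -> n \in supp (A i) -> x.1 != A i -> x.1 n = 0 :> nat.
    move=> xs ni ne; apply/eqP; rewrite -leqn0 leqNgt -mem_supp; apply/negP => nx.
    move: nx; rewrite -(fP _ xs) => nx.
    by move: ne; rewrite -(fP _ xs) (iblock_inj_supp nx ni) eqxx.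
  have val x n : x \in s -> n \in supp x.1 -> p n = x.1 n - x.2 :> nat.
    move=> xs nx; rewrite E (big_rem _ xs) /= /tetris big_seq big1 ?addn0 //.
    move=> y ys; rewrite (other _ _ (f x.1)) ?sub0n ?fP ?(mem_rem ys) //.
    move: us; rewrite (perm_uniq (perm_map _ (perm_to_rem xs))) /= => /andP [h _].
    by apply: contra h => /eqP <-; apply: map_f.
  have /choice [g gP] : forall i, exists j : nat,
      (forall x, x \in s -> x.1 = A i -> j = x.2) /\
      ((forall x, x \in s -> x.1 <> A i) -> j = k).
    move=> i.
    case: (pselect (exists2 x, x \in s & x.1 = A i)) => [[x xs xi]|nx].
      exists x.2; split=> [y ys yi|h]; last by case: (h x).
      have [n nx _] := FIN_top x.1.
      case/(nthP x0): xs => ix ixs ex; case/(nthP x0): ys => iy iys ey.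
      suff ixy : ix = iy by rewrite -ex -ey ixy.
      apply/eqP; rewrite -(nth_uniq (x0.1) _ _ us) ?size_map //.
      by rewrite !(nth_map x0) // ex ey xi yi.
    by exists k; split=> // x xs xi; case: nx; exists x.
  exists g; split.
  + exists (f x0.1); case: (gP (f x0.1)) => h _.
    by rewrite (h _ x0s) ?fP // x00.
  + move=> i n ni; case: (gP i) => h1 h2.
    case: (pselect (exists2 x, x \in s & x.1 = A i)) => [[x xs xi]|nx].
      by rewrite (h1 _ xs xi) -xi; apply: val; rewrite ?xi.
    have nx' x : x \in s -> x.1 <> A i by move=> xs xi; apply: nx; exists x.
    rewrite h2 // E big_seq big1; last first.
      by move=> x xs; rewrite /tetris (other _ _ i) //; apply/eqP; exact: nx'.
    by have := FIN_le (A i) n; lia.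
  + move=> n nA; rewrite E big_seq big1 // => x xs.
    have := nA (f x.1); rewrite fP // mem_supp -leqNgt leqn0 /tetris => /eqP ->.
    by [].
- case=> g [[i0 gi0] gA g0].
  (* The term [A i] lives at or beyond [i], so from index [N] on it misses [supp p] and its exponent
     erases it: a list of length [N] loses nothing. *)
  pose N := (fmax (supp p)).+1.
  have g_big i : N <= i -> k <= g i.
    move=> Ni; have [n ni En] := FIN_top (A i).
    have := iblock_supp_ge ni => le_in.
    have: n \notin supp p by apply/negP => /leq_fmax; rewrite -/N; lia.
    by rewrite mem_supp (gA _ _ ni) En; lia.
  have i0N : i0 < N.
    rewrite ltnNge; apply/negP => /g_big; rewrite gi0 leqNgt => /negP; apply.
    exact: FIN_gt0 p.
  exists [seq (A i, inord (minn k (g i))) | i <- iota 0 N]; split.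
  + rewrite /unzip1 -map_comp pairwise_map; apply: (sub_pairwise (r := ltn)).
      by move=> i j; exact: iblockP.
    by rewrite -(sorted_pairwise ltn_trans) iota_ltn_sorted.
  + by move=> x /mapP [i _ ->]; exists i.
  + exists (A i0, inord (minn k (g i0))); first by apply/map_f; rewrite mem_iota.
    by apply/val_inj; rewrite /= gi0 minn0 inordK.
  + move=> n; rewrite big_map.
    have tE i : tetris (inord (minn k (g i)) : 'I_k.+1) (A i) n = A i n - g i.
      rewrite /tetris inordK ?ltnS ?geq_minl //.
      by have := FIN_le (A i) n; lia.
    under eq_bigr do rewrite tE.
    have zero i : n \notin supp (A i) -> A i n = 0 :> nat.
      by rewrite mem_supp -leqNgt leqn0 => /eqP.
    case: (pselect (exists i, n \in supp (A i))) => [[i ni]|nA]; last first.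
      have nA' i : n \notin supp (A i) by apply/negP => ni; apply: nA; exists i.
      by rewrite g0 // big1 // => i _; rewrite zero.
    rewrite (gA _ _ ni).
    have oth j : j != i -> A j n - g j = 0.
      move=> ji; rewrite zero //; apply/negP => nj.
      by rewrite (iblock_inj_supp ni nj) eqxx in ji.
    case: (leqP N i) => iN.
      rewrite big_seq big1; first by have := FIN_le (A i) n; have := g_big _ iN; lia.
      by move=> j; rewrite mem_iota => /andP [_ jN]; apply: oth; lia.
    rewrite (bigD1_seq i) ?mem_iota ?iota_uniq //= big1 ?addn0 //.
Qed.

Lemma span_refl A i : span (terms A) (A i).
Proof.
apply/spanP; exists (fun j => if j == i then 0 else k); split.
- by exists i; rewrite eqxx.
- move=> j n nj; case: eqP => [->|/eqP ji]; first by rewrite subn0.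
  have: n \notin supp (A i).
    by apply/negP => ni; rewrite (iblock_inj_supp ni nj) eqxx in ji.
  by rewrite mem_supp; have := FIN_le (A j) n; lia.
- by move=> n /(_ i); rewrite mem_supp; lia.
Qed.

(** Exponents add under composition of the operations T^(j). Each [B j] contributes to at most one
    [A i], since a point where [B j] equals k would otherwise lie in two disjoint supports; so the
    exponent [G j] of [B j] in [p] is well defined. *)
Lemma sub_span A B p : terms A `<=` span (terms B) ->
  span (terms A) p -> span (terms B) p.
Proof.
move=> AB /spanP [g [[i0 gi0] gA g0]].
have /choice [h hP] : forall i, exists h : nat -> nat,
    [/\ exists j, h j = 0,
        forall j n, n \in supp (B j) -> A i n = B j n - h j :> nat
      & forall n, (forall j, n \notin supp (B j)) -> A i n = 0 :> nat].
  by move=> i; apply/spanP/AB; exists i.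
have h_uniq i i' j : h i j < k -> h i' j < k -> i = i'.
  move=> hi hi'; have [n nj En] := FIN_top (B j).
  case: (hP i) => _ /(_ _ _ nj) Ei _; case: (hP i') => _ /(_ _ _ nj) Ei' _.
  by apply: (@iblock_inj_supp A i i' n); rewrite mem_supp; lia.
have /choice [G GP] : forall j, exists e : nat,
    (forall i, h i j < k -> e = g i + h i j) /\
    ((forall i, k <= h i j) -> e = k).
  move=> j.
  case: (pselect (exists i, h i j < k)) => [[i hi]|nh].
    exists (g i + h i j); split=> [i' /(h_uniq _ _ _ hi) <- //|/(_ i)].
    by rewrite leqNgt hi.
  by exists k; split=> // i hi; case: nh; exists i.
apply/spanP; exists G; split.
- case: (hP i0) => [[j hj] _ _]; exists j; case: (GP j) => /(_ i0) -> //.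
    by rewrite gi0 hj.
  by rewrite hj; exact: FIN_gt0 p.
- move=> j n nj; case: (GP j) => GP1 GP2.
  have BA i : n \in supp (A i) -> h i j < k.
    case: (hP i) => _ /(_ _ _ nj) Ei _; rewrite mem_supp Ei.
    by have := FIN_le (B j) n; lia.
  case: (pselect (exists i, n \in supp (A i))) => [[i ni]|nA].
    rewrite (gA _ _ ni) (GP1 _ (BA _ ni)).
    by case: (hP i) => _ /(_ _ _ nj) -> _; lia.
  have nA' i : n \notin supp (A i) by apply/negP => ni; apply: nA; exists i.
  rewrite g0 //; case: (pselect (exists i, h i j < k)) => [[i hi]|nh].
    rewrite (GP1 _ hi); move: (nA' i); rewrite mem_supp.
    by case: (hP i) => _ /(_ _ _ nj) -> _; lia.
  rewrite GP2; first by have := FIN_le (B j) n; lia.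
  by move=> i; rewrite leqNgt; apply/negP => hi; apply: nh; exists i.
- move=> n nB; apply: g0 => i; case: (hP i) => _ _ /(_ _ nB).
  by rewrite mem_supp => ->.
Qed.

Lemma iblock_le_refl A : iblock_le A A.
Proof. by move=> _ [i _ <-]; exact: span_refl. Qed.

Lemma iblock_le_trans B A C : iblock_le A B -> iblock_le B C -> iblock_le A C.
Proof. by move=> AB BC p /AB; exact: sub_span. Qed.

(** * Tails of block sequences *)

Lemma drop_iblockP A m i j : i < j -> block_lt (A (m + i)) (A (m + j)).
Proof. by move=> ij; apply: iblockP; rewrite ltn_add2l. Qed.

Definition idrop m A : iblock k := MkIblock (@drop_iblockP A m).

Lemma supp_lt_ex S A : exists m, supp_lt S (supp (A m)).
Proof.
exists (fmax S).+1; apply/supp_ltP => x y /leq_fmax xS /iblock_supp_ge; lia.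
Qed.

(** This is A/S as a genuine infinite block sequence, whereas [after S A] is only a set of terms. *)
Definition tail S A : iblock k := idrop (ex_minn (supp_lt_ex S A)) A.

Lemma tailE S A : terms (tail S A) = after S A.
Proof.
rewrite /tail; case: ex_minnP => m mS mmin; apply/seteqP; split.
  move=> _ [i _ <-] /=; split; first by exists (m + i).
  case: i => [|i]; first by rewrite addn0.
  apply/supp_ltP => x y xS yi; have [n nm _] := FIN_top (A m).
  have/block_ltP/(_ _ _ nm yi) : block_lt (A m) (A (m + i.+1)) by apply: iblockP; lia.
  by move/supp_ltP: mS => /(_ _ _ xS nm); lia.
move=> _ [[i _ <-] iS]; exists (i - m) => //=.
by rewrite subnKC // mmin.
Qed.

Lemma tail_sub S A : terms (tail S A) `<=` terms A.
Proof. by rewrite tailE => p []. Qed.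

Lemma sub_iblock_le A B : terms A `<=` terms B -> iblock_le A B.
Proof. by move=> AB p /AB [i _ <-]; exact: span_refl. Qed.

Lemma tail_le S A : iblock_le (tail S A) A.
Proof. exact/sub_iblock_le/tail_sub. Qed.

Lemma span_after S A p : span (terms (tail S A)) p -> supp_lt S (supp p).
Proof.
move=> /spanP [g [_ gA g0]]; apply/supp_ltP => x y xS.
rewrite mem_supp => yp; case: (pselect (exists i, y \in supp (tail S A i))).
  move=> [i yi]; have [_ /supp_ltP] : after S A (tail S A i).
    by rewrite -tailE; exists i.
  by apply.
move=> nA; rewrite g0 // in yp => i; apply/negP => yi; by apply: nA; exists i.
Qed.

(* If A i contributes to p, the place where A i equals k lies in supp p, hence
   above S.  The hypothesis on S then forces all of A i above S. *)
Lemma span_tail S A p :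
  (forall x, x \in S -> (forall i y, y \in supp (A i) -> x < y) \/
     exists q, [/\ span (terms A) q, x \in supp q & {subset supp q <= S}]) ->
  span (terms A) p -> supp_lt S (supp p) -> span (terms (tail S A)) p.
Proof.
move=> SA /spanP [g [[i0 gi0] gA g0]] /supp_ltP Sp.
have g_after i : g i < k -> supp_lt S (supp (A i)).
  move=> gi; apply/supp_ltP => x y xS yi; case: (SA _ xS) => [h|]; first exact: h yi.
  move=> [q [/spanP [h [_ hA h0]] xq qS]].
  case: (pselect (exists j, x \in supp (A j))) => [[j xj]|nx]; last first.
    by move: xq; rewrite mem_supp h0 // => j; apply/negP => xj; apply: nx; exists j.
  have [ni ni_in Eni] := FIN_top (A i); have [nj nj_in Enj] := FIN_top (A j).
  have pni : ni \in supp p by rewrite mem_supp (gA _ _ ni_in) Eni subn_gt0.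
  have qnj : nj \in supp q.
    move: xq; rewrite !mem_supp (hA _ _ xj) (hA _ _ nj_in) Enj.
    by have := FIN_le (A j) x; lia.
  (* The points [nj] and [ni], where [A j] and [A i] reach k, lie in [S] and in [supp p], so
     [nj < ni] and j cannot exceed i. If j = i, then [ni] would lie both in [supp q], hence in [S],
     and in [supp p]. *)
  have lt_n := Sp _ _ (qS _ qnj) pni.
  case: (ltngtP j i) => ji.
  - by have/block_ltP := iblockP A ji; apply.
  - by have/block_ltP/(_ _ _ ni_in nj_in) := iblockP A ji; lia.
  - have ij := iblock_inj_supp ni_in; subst j.
    have := Sp _ _ (qS ni _) pni; rewrite ltnn mem_supp (hA _ _ ni_in) Eni.
    by move: qnj; rewrite mem_supp (hA _ _ nj_in) Enj => -> /(_ isT).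
have tE i : supp_lt S (supp (A i)) -> exists j, tail S A j = A i.
  move=> h; have [j _ Ej] : terms (tail S A) (A i).
    by rewrite tailE; split => //; exists i.
  by exists j.
have tA j : exists i, tail S A j = A i.
  have [i _ <-] : terms A (tail S A j) by apply: (@tail_sub S); exists j.
  by exists i.
have [G GP] := choice tA.
apply/spanP; exists (g \o G); split.
- have [|j Ej] := tE i0; first by apply: g_after; rewrite gi0; exact: FIN_gt0 p.
  by exists j; rewrite /= -gi0; congr g; apply: (@iblock_inj A); rewrite -GP.
- by move=> j n; rewrite GP; exact: gA.
- move=> n nt; case: (pselect (exists i, n \in supp (A i))) => [[i ni]|nA]; last first.
    by apply: g0 => i; apply/negP => ni; apply: nA; exists i.
  rewrite (gA _ _ ni); case: (ltnP (g i) k) => [/g_after/tE [j Ej]|].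
    by move: (nt j); rewrite Ej ni.
  by have := FIN_le (A i) n; lia.
Qed.

(** * Initial segments and basic sets *)

Lemma fblock_suppP a n :
  reflect (exists2 p, p \in fblock_val a & n \in supp p) (n \in fblock_supp a).
Proof.
apply: (iffP (bigfcupP _ _ _ _)) => [[p]|[p pa np]].
  by rewrite andbT; exists p.
by exists p; rewrite ?pa.
Qed.

Lemma restr_suppP A m n :
  reflect (exists2 i, i < m & n \in supp (A i)) (n \in fblock_supp (restr A m)).
Proof.
apply: (iffP (fblock_suppP _ _)) => [[_ /mapP [i im ->] ni]|[i im ni]].
  by exists i; rewrite // mem_iota in im.
by exists (A i) => //; apply: map_f; rewrite mem_iota.
Qed.

Lemma size_restr A n : size (restr A n) = n.
Proof. exact: size_mkseq. Qed.

Lemma restr_eqP A B n :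
  (forall i, i < n -> A i = B i) <-> restr A n = restr B n.
Proof.
split=> [AB|[] /eq_in_map AB i ltin]; last by apply: AB; rewrite mem_iota.
by apply/val_inj/eq_in_map => i; rewrite mem_iota => /AB.
Qed.

Lemma restr_eq_leq A B m n : m <= n -> restr A n = restr B n -> restr A m = restr B m.
Proof.
by move=> mn /restr_eqP AB; apply/restr_eqP => i im; apply: AB; apply: leq_trans mn.
Qed.

Lemma initialE a A : initial a A <-> a = restr A (size a).
Proof. by split=> [[n ->]|->]; [rewrite size_restr | exists (size a)]. Qed.

Lemma after_restr A n i : n <= i -> after (fblock_supp (restr A n)) A (A i).
Proof.
move=> ni; split; first by exists i.
apply/supp_ltP => x y /restr_suppP [j jn xj] yi.
by have/block_ltP := iblockP A (leq_trans jn ni); apply.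
Qed.

Lemma after_subset S S' A : {subset S <= S'} -> after S' A `<=` after S A.
Proof.
move=> SS' p [Ap /supp_ltP h]; split=> //; apply/supp_ltP => x y /SS'; exact: h.
Qed.

Lemma restr_supp_subset A m n : m <= n ->
  {subset fblock_supp (restr A m) <= fblock_supp (restr A n)}.
Proof.
move=> mn x /restr_suppP [i im xi]; apply/restr_suppP; exists i => //.
exact: leq_trans mn.
Qed.

(* This is not the same as [after (fblock_supp b) B `<=` span (terms A)]: a term
   of [B] meeting the support of [b] can have a T^(j)-image above [b]. *)
Definition le_at b B A : Prop :=
  forall p, span (terms B) p -> supp_lt (fblock_supp b) (supp p) -> span (terms A) p.

Lemma iblock_le_at b B A : iblock_le B A -> le_at b B A.
Proof. by move=> BA p Bp _; exact: sub_span BA Bp. Qed.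

Lemma le_at_refl b B : le_at b B B.
Proof. by []. Qed.

Lemma le_at_trans b B A C : le_at b A B -> le_at b B C -> le_at b A C.
Proof. by move=> AB BC p Ap bp; apply: BC => //; exact: AB. Qed.

Lemma basic_le_at b B A : le_at b B A -> basic b B `<=` basic b A.
Proof.
move=> BA C [bC CB]; split=> // p Cp; apply: BA; first exact: CB.
by case: Cp.
Qed.

Lemma basic_le b B A : iblock_le B A -> basic b B `<=` basic b A.
Proof. by move/iblock_le_at => /(_ b); exact: basic_le_at. Qed.

Lemma le_at_tail b B A : le_at b B A -> iblock_le (tail (fblock_supp b) B) A.
Proof.
move=> BA _ [i _ <-]; apply: BA; first exact: sub_span (@tail_le _ _) (span_refl _ _).
exact/span_after/span_refl.
Qed.

Lemma basic_restr a B C n : basic a B C -> size a <= n -> basic (restr C n) B C.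
Proof.
move=> [/initialE -> CB]; rewrite size_restr => an; split; first by exists n.
apply: subset_trans CB; apply: after_subset; exact: restr_supp_subset.
Qed.

Lemma basic_term a B C n : basic a B C -> size a <= n -> span (terms B) (C n).
Proof.
move=> [/initialE aC CB] an; apply: CB; rewrite aC; exact: after_restr.
Qed.

Lemma sub_basic_restr a B C n : basic a B C -> size a <= n ->
  basic (restr C n) B `<=` basic a B.
Proof.
move=> aC an D [/initialE]; rewrite size_restr => CD DB.
have aD : a = restr D (size a).
  by case: aC => /initialE aE _; rewrite {1}aE; exact: restr_eq_leq an CD.
split; first by exists (size a).
(* Three ranges of indices: terms of [a] are not above [a], terms between [size a] and [n] are
   shared with [C], and later terms are above [restr C n]. *)
move=> _ [[i _ <-] aDi]; case: (ltnP i (size a)) => ia.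
  have [x xi _] := FIN_top (D i).
  have xa : x \in fblock_supp a by rewrite aD; apply/restr_suppP; exists i.
  by move/supp_ltP: aDi => /(_ _ _ xa xi); rewrite ltnn.
case: (ltnP i n) => i_n; last by apply: DB; rewrite CD; exact: after_restr.
move/restr_eqP: CD => <- //; exact: basic_term aC ia.
Qed.

(** * Prefixing a finite block sequence *)

Section Append.

Variables (a : fblock k) (A : iblock k).
Let c : FIN k := A 0.
Let T := tail (fblock_supp a) A.
Let append_fun n := if n < size a then nth c a n else T (n - size a).

Fact append_subproof m n : m < n -> block_lt (append_fun m) (append_fun n).
Proof.
rewrite /append_fun => mn; case: ifP => ma; case: ifP => na.
- have /(pairwiseP c) pa : pairwise (@block_lt k) a by case: (a).
  by apply: pa; rewrite ?inE.
- apply/block_ltP => x y xm yn.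
  have [_ /supp_ltP] : after (fblock_supp a) A (T (n - size a)).
    by rewrite -tailE; exists (n - size a).
  by apply=> //; apply/fblock_suppP; exists (nth c a m) => //; exact: mem_nth.
- lia.
- apply: iblockP; lia.
Qed.

(** Elements of [a,A] must begin with [a]; this puts [a] in front of the tail of [A], so that
    arguments can be run with plain [iblock_le] and the prefix restored at the end. The term [c] is
    only a default for [nth]. *)
Definition append : iblock k := MkIblock append_subproof.

Lemma restr_append : restr append (size a) = a.
Proof.
apply/val_inj/(@eq_from_nth _ c); rewrite /= size_mkseq // => i ia.
by rewrite nth_mkseq //= /append_fun ia.
Qed.

Lemma terms_append_after : after (fblock_supp a) append = terms T.
Proof.
apply/seteqP; split=> p.
  case=> [[n _ <-]] /=; rewrite /append_fun; case: ifP => [na|_ _]; last by exists (n - size a).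
  have [x xn _] := FIN_top (nth c a n).
  have xa : x \in fblock_supp a.
    by apply/fblock_suppP; exists (nth c a n) => //; exact: mem_nth.
  by move=> /supp_ltP /(_ _ _ xa xn); rewrite ltnn.
case=> n _ <-; have -> : T n = append (size a + n).
  by rewrite /= /append_fun ltnNge leq_addr addKn.
by rewrite -{1}restr_append; apply: after_restr; exact: leq_addr.
Qed.

Lemma basic_append : basic a A append.
Proof.
split; first by apply/initialE; rewrite restr_append.
rewrite terms_append_after; exact: tail_le.
Qed.

Lemma tail_le_append : iblock_le T append.
Proof. by apply: sub_iblock_le; rewrite -terms_append_after => p []. Qed.

(** Every point of the support of [a] lies in a term of [append] supported inside that set, so
    [span_tail] removes the prefix. *)
Lemma append_le_at : le_at a append A.
Proof.
move=> p /span_tail h /h {}h; apply: (@sub_span T); first exact: tail_le.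
suff <- : terms (tail (fblock_supp a) append) = terms T.
  apply: h => x xa; right; have /fblock_suppP [q qa xq] := xa.
  exists q; split=> //; last by move=> y yq; apply/fblock_suppP; exists q.
  have -> : q = append (index q a) by rewrite /= /append_fun index_mem qa nth_index.
  exact: span_refl.
by rewrite tailE terms_append_after.
Qed.

End Append.

(* Every term of [restr C n] is either below all of [B] or in the span of [B],
   so [span_tail] applies. *)
Lemma restr_le_at a B C A n : iblock_le B (tail (fblock_supp a) A) ->
  basic a B C -> size a <= n ->
  forall D, after (fblock_supp (restr C n)) B `<=` span (terms D) ->
  le_at (restr C n) B D.
Proof.
move=> BA aBC an D BD p Bp bp; apply: (@sub_span (tail (fblock_supp (restr C n)) B)).
  by rewrite tailE.
apply: span_tail bp => // x /restr_suppP [i im xi].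
case: (ltnP i (size a)) => [ia|ai].
  left=> j y yj; have /span_after/supp_ltP : span (terms (tail (fblock_supp a) A)) (B j).
    by apply: BA; exists j.
  apply=> //; case: aBC => /initialE -> _; apply/restr_suppP; exists i => //.
right; exists (C i); split=> //; first exact: basic_term aBC ai.
by move=> y yi; apply/restr_suppP; exists i.
Qed.

(** * Coideals are closed under tails *)

Section Coideal.

Variable H : set (iblock k).
Hypothesis H_coideal : coideal H.

Lemma coideal_up A B : iblock_le A B -> H A -> H B.
Proof. by case: H_coideal => h _; exact: h. Qed.

(** Split [A] into the terms that are not above [S] and those that are. The first piece is finite,
    so all elements of its span have support bounded by some [M]; no infinite block sequence [D]
    fits there, as [D M.+1] is supported beyond [M]. *)
Lemma coideal_tail S A : H A -> H (tail S A).
Proof.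
move=> HA; case: H_coideal => _ /(_ _ HA (terms A `\` after S A) (after S A)).
case.
- by rewrite setUC setDUK // => p [].
- exact: setDKI.
- move=> D [HD [DB|]]; last by rewrite -tailE => DT; exact: coideal_up HD.
have [m mS] := supp_lt_ex S A.
have lt_m i : ~ after S A (A i) -> i < m.
  move=> nA; rewrite ltnNge; apply/negP => mi; apply: nA; split; first by exists i.
  case: (ltngtP m i) mi => // [mi|<- //] _; apply/supp_ltP => x y xS yi.
  have [n nm _] := FIN_top (A m); have/block_ltP/(_ _ _ nm yi) := iblockP A mi.
  by move/supp_ltP: mS => /(_ _ _ xS nm); lia.
pose M := \max_(i < m) fmax (supp (A i)).
have [n nM _] := FIN_top (D M.+1); have := iblock_supp_ge nM.
have [s [_ sB _ E]] : span (terms A `\` after S A) (D M.+1) by apply: DB; exists M.+1.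
case: (pselect (exists2 x, x \in s & n \in supp x.1)) => [[x xs nx]|nx].
  have [[i _ Ei] nA] := sB _ xs; rewrite -Ei in nA nx.
  have := leq_bigmax (Ordinal (lt_m _ nA)) (F := fun i : 'I_m => fmax (supp (A i))).
  by rewrite -/M /=; have := leq_fmax nx; lia.
move: nM; rewrite mem_supp E big_seq big1 // => x xs.
have : n \notin supp x.1 by apply/negP => h; apply: nx; exists x.
by rewrite mem_supp -leqNgt leqn0 /tetris => /eqP ->.
Qed.

Lemma coideal_le_at b B A : H B -> le_at b B A ->
  H (tail (fblock_supp b) B) /\ iblock_le (tail (fblock_supp b) B) A.
Proof. by move=> HB BA; split; [exact: coideal_tail | exact: le_at_tail]. Qed.

End Coideal.

End BlockSequences.

(** * Fusion from semiselectivity *)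

Section RamseyTheory.

Variables (k : nat) (H : set (iblock k)).
Hypothesis H_coideal : coideal H.
Implicit Types (a b s : fblock k) (A B C D : iblock k) (X Y : set (iblock k)).

(** The code [pickle] enumerates [T]; the conditions are met one code at a time, and downward
    closure preserves those already met. *)
Lemma finite_density (T : countType) (Q : T -> set (iblock k)) :
  (forall t A B, Q t A -> iblock_le B A -> Q t B) ->
  (forall t A, H A -> exists B, [/\ H B, iblock_le B A & Q t B]) ->
  forall M A, H A ->
    exists B, [/\ H B, iblock_le B A & forall t, choice.pickle t < M -> Q t B].
Proof.
move=> Qdown Qdense; elim=> [|M IH] A HA.
  by exists A; split=> //; exact: iblock_le_refl.
have [B [HB BA BQ]] := IH _ HA.
case: (pselect (exists t : T, choice.pickle t = M)) => [[t tM]|nt].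
  have [D [HD DB DQ]] := Qdense t B HB; exists D; split=> //.
    exact: iblock_le_trans BA.
  move=> u; rewrite ltnS leq_eqVlt => /orP [/eqP uM|/BQ uB].
    by rewrite (_ : u = t) //; apply: (pcan_inj choice.pickleK); rewrite uM.
  exact: Qdown uB DB.
exists B; split=> // u; rewrite ltnS leq_eqVlt => /orP [/eqP uM|/BQ //].
by case: nt; exists u.
Qed.

Lemma fblock_supp_ge b p i x :
  i < size b -> x \in supp (nth p b i) -> i <= x.
Proof.
have /(pairwiseP p) pw : pairwise (@block_lt k) b by case: (b).
elim: i x => // i IH x ib xi; have [m mi _] := FIN_top (nth p b i).
have /block_ltP/(_ _ _ mi xi) : block_lt (nth p b i) (nth p b i.+1).
  by apply: pw; rewrite ?inE //; exact: ltnW.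
by apply: leq_ltn_trans; apply: IH => //; exact: ltnW.
Qed.

(** Only finitely many finite block sequences are supported in {0,...,n}: the i-th term lives at or
    beyond i, so at most n+1 terms occur, and the zero-padded matrix of their values is an injective
    code into a finite type. *)
Lemma bounded_fblocks (n : nat) :
  exists M, forall b, (forall x, x \in fblock_supp b -> x <= n) -> choice.pickle b < M.
Proof.
pose bounded b := forall x, x \in fblock_supp b -> x <= n.
pose digit b (i j : nat) : nat := nth 0 [seq val (p j) | p : FIN k <- b] i.
have digitE b p i j : i < size b -> digit b i j = nth p b i j.
  by move=> ib; rewrite /digit (nth_map p).
have digit_dflt b i j : size b <= i -> digit b i j = 0.
  by move=> ib; rewrite /digit nth_default ?size_map.
have digit_le b i j : digit b i j <= k.
  case: (ltnP i (size b)) => ib; last by rewrite digit_dflt.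
  case: b ib => -[|p s] //= pw ib; rewrite (digitE _ p) //; exact: FIN_le.
have digit0 b i j : bounded b -> n < i \/ n < j -> digit b i j = 0.
  move=> bb nij; case: (ltnP i (size b)) => [ib|/digit_dflt //].
  apply/eqP; rewrite -leqn0 leqNgt; apply/negP.
  have [p _] : exists p : FIN k, p \in fblock_val b.
    by case: b ib {bb} => -[|p s] //= pw _; exists p; rewrite mem_head.
  rewrite (digitE _ p) // -mem_supp => jp; have := fblock_supp_ge ib jp.
  have : j <= n by apply: bb; apply/fblock_suppP; exists (nth p b i) => //; exact: mem_nth.
  lia.
pose code b : {ffun 'I_n.+1 * 'I_n.+1 -> 'I_k.+1} :=
  [ffun ij => inord (digit b (val ij.1) (val ij.2))].
have code_inj b b' : bounded b -> bounded b' -> code b = code b' -> b = b'.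
  move=> bb bb' /ffunP E; have dE i j : digit b i j = digit b' i j.
    case: (leqP i n) => i_n; last by rewrite !digit0 //; left.
    case: (leqP j n) => j_n; last by rewrite !digit0 //; right.
    have := E (inord i, inord j); rewrite !ffunE /= !inordK //.
    by move/(congr1 val); rewrite /= !inordK ?ltnS.
  (* Zero padding does not hide the length, because each term takes the positive value k
     somewhere. *)
  have size_sub c c' : (forall i j, digit c i j = digit c' i j) -> size c <= size c'.
    move=> cc'; rewrite leqNgt; apply/negP => lt_c.
    have [p _] : exists p : FIN k, p \in fblock_val c.
      by case: c lt_c {cc'} => -[|p s] //= pw _; exists p; rewrite mem_head.
    have [m _ Em] := FIN_top (nth p c (size c')); have := cc' (size c') m.
    by rewrite (digitE _ p) // digit_dflt // Em; have := FIN_gt0 p; lia.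
  have sE : size b = size b' by apply/eqP; rewrite eqn_leq !size_sub.
  apply: val_inj => /=; case: (posnP (size b)) => [b0|b_gt0].
    by move: (b0); rewrite sE => /size0nil ->; exact: size0nil.
  have [p _] : exists p : FIN k, p \in fblock_val b.
    by case: b b_gt0 {bb E dE sE} => -[|p s] //= pw _; exists p; rewrite mem_head.
  apply: (@eq_from_nth _ p) => // i ib; apply: FIN_eq => j.
  by rewrite -!digitE // -sE.
have /choice [g gP] : forall c, exists m : nat,
    forall b, bounded b -> code b = c -> choice.pickle b < m.
  move=> c; case: (pselect (exists b, bounded b /\ code b = c)) => [[b [bb bc]]|nb].
    exists (choice.pickle b).+1 => b' bb' bc'; rewrite (code_inj b b') //; congruence.
  by exists 0 => b bb bc; case: nb; exists b.
exists (\max_c g c) => b bb; apply: leq_trans (gP _ _ bb erefl) _.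
exact: leq_bigmax.
Qed.

Section Semiselective.

Hypothesis H_semiselective : semiselective H.

(** Let [D n] require [P b] for the finitely many [b] supported in {0,...,n}, and diagonalize. If
    [p] is the last term of [restr C n.+1], taken from the span of [B], then B/p lies below the
    sequence that handles all [b] up to the maximum of [supp p], and [restr C n.+1] is such a
    [b]. *)
Lemma fusion (P : fblock k -> set (iblock k)) :
  (forall b A B, P b A -> le_at b B A -> P b B) ->
  (forall b A, H A -> exists B, [/\ H B, iblock_le B A & P b B]) ->
  forall a A, H A -> exists B, [/\ H B, iblock_le B A
    & forall C n, basic a B C -> size a <= n -> P (restr C n) B].
Proof.
(* The segment [a] itself is handled beforehand, since its last term need not be in the span of [B].
   Working below the tail of [A0] keeps [B] above [a], as [restr_le_at] requires. *)
move=> Pdown Pdense a A HA; have [A0 [HA0 A0A PaA0]] := Pdense a A HA.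
pose D n : set (iblock k) := [set B | H B /\
  forall b, (forall x, x \in fblock_supp b -> x <= n) -> P b B].
have D_dense n : dense_open H (D n).
  split=> [B [] //|B C [HC PC] HB BC|B HB].
    by split=> // b bn; apply: Pdown (PC _ bn) _; exact: iblock_le_at.
  have [M MP] := bounded_fblocks n.
  have [|B1 [HB1 B1B B1P]] := finite_density _ Pdense M HB.
    by move=> b B1 B2 PB1 B21; apply: Pdown PB1 _; exact: iblock_le_at.
  by exists B1; split=> //; split=> // b /MP; exact: B1P.
have [As [_ AsD [B [HB BA0 Bdiag]]]] :=
  H_semiselective (coideal_tail H_coideal (fblock_supp a) HA0) D_dense.
have BA0' : iblock_le B A0 := iblock_le_trans BA0 (@tail_le _ _ _).
exists B; split=> //; first exact: iblock_le_trans BA0' A0A.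
move=> C n aBC; rewrite leq_eqVlt => /orP [/eqP <-|an].
  case: aBC => /initialE <- _; apply: Pdown PaA0 _; exact: iblock_le_at.
case: n an => // n an; pose p := C n.
have Bp : span (terms B) p := basic_term aBC an.
have sub_p x : x \in fblock_supp (restr C n.+1) -> x <= fmax (supp p).
  move=> /restr_suppP [i]; rewrite ltnS leq_eqVlt => /orP [/eqP ->|i_n] xi.
    exact: leq_fmax.
  have [y yp _] := FIN_top p; apply: leq_trans (leq_fmax yp).
  by have/block_ltP/(_ _ _ xi yp)/ltnW := iblockP C i_n.
have [_ /(_ _ sub_p) PAs] := AsD (fmax (supp p)).
apply: Pdown PAs _; apply: restr_le_at BA0 aBC (ltnW an) _ _.
apply: subset_trans (Bdiag _ Bp); apply: after_subset => x xp.
by apply/restr_suppP; exists n.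
Qed.

(** * Deciding sets and first closure properties *)

Definition decided X b B := basic b B `<=` X \/ basic b B `&` X = set0.

Lemma decided_le_at X b A B : decided X b A -> le_at b B A -> decided X b B.
Proof.
move=> [AX|AX] /basic_le_at BA; [left | right].
  exact: subset_trans BA AX.
by apply: subsetI_eq0 AX => //.
Qed.

Lemma decidedC X b B : decided X b B -> decided (~` X) b B.
Proof.
move=> [BX|BX]; [right | left]; last exact/disjoints_subset.
by apply/disjoints_subset; rewrite setCK.
Qed.

(** This trades membership in [b,A] for [iblock_le], which iterates well: [tail] discards the prefix
    in one direction and [append] restores it in the other. *)
Lemma RamseyP X : Ramsey H X <->
  forall A, H A -> forall b, exists B, [/\ H B, iblock_le B A & decided X b B].
Proof.
split=> RX A HA b; have [] := RX _ HA b.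
  move=> B [[bB BA] HB BX]; exists (tail (fblock_supp b) B); split.
  - exact: coideal_tail.
  - by rewrite /iblock_le tailE.
  - by apply: decided_le_at BX _; apply: iblock_le_at; exact: tail_le.
move=> B [HB BA BX]; exists (append b B); split.
- exact: basic_le BA _ (basic_append _ _).
- by apply: (coideal_up H_coideal (@tail_le_append _ b B)); exact: coideal_tail.
- apply: decided_le_at BX _; exact: append_le_at.
Qed.

Lemma Ramsey_setC X : Ramsey H X -> Ramsey H (~` X).
Proof.
move=> /RamseyP RX; apply/RamseyP => A HA b; have [B [HB BA BX]] := RX _ HA b.
by exists B; split=> //; exact: decidedC.
Qed.

Lemma Ramsey_set0 : Ramsey H set0.
Proof.
apply/RamseyP => A HA b; exists A; split=> //; first exact: iblock_le_refl.
by right; rewrite setI0.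
Qed.

(** At a segment of length n only the sets with code at most n are decided; this is a finite task,
    hence dense, yet every [t] is reached along any [C]. *)
Lemma Ramsey_fusion (T : countType) (Y : T -> set (iblock k)) :
  (forall t, Ramsey H (Y t)) ->
  forall a A, H A -> exists B, [/\ H B, iblock_le B A
    & forall C n t, basic a B C -> size a <= n -> choice.pickle t <= n ->
        decided (Y t) (restr C n) B].
Proof.
move=> RY a A HA.
pose P b B := forall t, choice.pickle t < (size b).+1 -> decided (Y t) b B.
have [||B [HB BA BP]] := @fusion P _ _ a A HA.
- by move=> b B1 B2 PB1 B21 t tb; apply: decided_le_at (PB1 _ tb) B21.
- move=> b B0; apply: finite_density => [t B1 B2 B1t B21|t B1 HB1].
    by apply: decided_le_at B1t _; exact: iblock_le_at.
  by have /RamseyP := RY t; apply.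
- exists B; split=> // C n t aBC an tn; apply: BP => //; by rewrite size_restr.
Qed.

(** * Galvin's dichotomy from the Gowers property *)

Section Gowers.

Hypothesis H_Gowers : Gowers H.

Lemma Gowers_pred (f : FIN k -> Prop) A : H A -> exists B, [/\ H B, iblock_le B A
  & (forall p, span (terms B) p -> f p) \/ (forall p, span (terms B) p -> ~ f p)].
Proof.
move=> HA.
have [B [HB BA [c cB]]] :=
  @H_Gowers 2 isT A HA (fun p => if pselect (f p) then ord0 else ord_max).
exists B; split=> //; case: (eqVneq c ord0) => c0; [left | right] => p /cB.
  by rewrite c0; case: pselect.
by case: pselect => //= _ cE; rewrite -cE eqxx in c0.
Qed.

(** Combinatorial forcing by acceptance and rejection. A first fusion makes every segment accepted
    or rejected, the Gowers property makes all one-term extensions of a segment behave alike, and a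
    second fusion does this for all segments at once; rejection then propagates from [a] to all its
    extensions. *)
Lemma Galvin (F : set (fblock k)) a A : H A -> exists B, [/\ H B, iblock_le B A
  & (forall C, basic a B C -> exists2 n, size a <= n & F (restr C n)) \/
    (forall C n, basic a B C -> size a <= n -> ~ F (restr C n))].
Proof.
move=> HA.
pose acc b B := forall C, basic b B C -> exists2 n, size b <= n & F (restr C n).
pose rej b B := forall B', H B' -> le_at b B' B -> ~ acc b B'.
have acc_down b B1 B2 : acc b B1 -> le_at b B2 B1 -> acc b B2.
  by move=> accB /basic_le_at B21 C /B21; exact: accB.
have rej_down b B1 B2 : rej b B1 -> le_at b B2 B1 -> rej b B2.
  by move=> rejB B21 B3 HB3 B32; apply: rejB => //; exact: le_at_trans B32 B21.
pose P b B := acc b B \/ rej b B.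
have P_down b B1 B2 : P b B1 -> le_at b B2 B1 -> P b B2.
  by case=> h B21; [left; exact: acc_down B21 | right; exact: rej_down B21].
have P_dense b B : H B -> exists B', [/\ H B', iblock_le B' B & P b B'].
  move=> HB; case: (pselect (rej b B)) => [rB|/existsNP [B1]].
    by exists B; split=> //; [exact: iblock_le_refl | right].
  move=> /not_implyP [HB1 /not_implyP [B1B /contrapT accB1]].
  have [HB2 B2B] := coideal_le_at H_coideal HB1 B1B.
  exists (tail (fblock_supp b) B1); split=> //; left; apply: acc_down accB1 _.
  by apply: iblock_le_at; exact: tail_le.
pose Q b B := acc b B \/
  (rej b B /\ forall C, basic b B C -> rej (restr C (size b).+1) B).
have Q_down b B1 B2 : Q b B1 -> le_at b B2 B1 -> Q b B2.
  case=> [h|[rb rC]] B21; [left; exact: acc_down B21 | right; split].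
    exact: rej_down B21.
  move=> C bC; apply: rej_down (rC C _) _; first exact: basic_le_at B21 _ bC.
  move=> p Bp Cp; apply: B21 => //; apply/supp_ltP => x y xb yp.
  move/supp_ltP: Cp; apply=> //; case: bC => /initialE bE _.
  by apply: restr_supp_subset (leqnSn _) _ _; rewrite -bE.
have Q_dense b B : H B -> exists B', [/\ H B', iblock_le B' B & Q b B'].
  move=> HB; have [B0 [HB0 B0B [accB0|rejB0]]] := P_dense b B HB.
    by exists B0; split=> //; left.
  have [B1 [HB1 B10 PB1]] := fusion P_down P_dense b HB0.
  have [B2 [HB2 B2T colour]] := Gowers_pred
    (* The colour of [p] tells whether [b] followed by [p] is accepted; the extension is written as
       a restriction of any [C] realising it, and all such [C] give the same one. *)
    (fun p => forall C, basic b B1 C -> C (size b) = p -> acc (restr C (size b).+1) B1)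
    (coideal_tail H_coideal (fblock_supp b) HB1).
  have B21 : iblock_le B2 B1 := iblock_le_trans B2T (@tail_le _ _ _).
  have B20 : iblock_le B2 B0 := iblock_le_trans B21 B10.
  exists B2; split=> //; first exact: iblock_le_trans B20 B0B.
  case: colour => [acc2|nacc2].
    have accB2 : acc b B2.
      move=> C bC; have B1C := basic_le B21 bC.
      have [n bn FC] := acc2 _ (basic_term bC (leqnn _)) C B1C erefl C
        (basic_restr B1C (leqnSn _)).
      by exists n => //; apply: leq_trans bn; rewrite size_restr.
    by left.
  right; split; first by apply: rej_down rejB0 _; exact: iblock_le_at.
  move=> C bC; have B1C := basic_le B21 bC.
  have [//|acc1|rej1] := PB1 _ (size b).+1 B1C; last first.
    by apply: rej_down rej1 _; exact: iblock_le_at.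
  case: (nacc2 _ (basic_term bC (leqnn _))) => C' bC' E.
  suff -> : restr C' (size b).+1 = restr C (size b).+1 by [].
  case: bC bC' => /initialE bC _ [/initialE bC' _].
  have /restr_eqP CC' : restr C' (size b) = restr C (size b) by rewrite -bC -bC'.
  by apply/restr_eqP => i; rewrite ltnS leq_eqVlt => /orP [/eqP -> //|/CC'].
have [B [HB BA QB]] := fusion Q_down Q_dense a HA.
exists B; split=> //.
have restrC_a C : basic a B C -> restr C (size a) = a by case=> /initialE.
(* A segment in [F] is accepted trivially, being its own witness. *)
have rej_no n C : basic a B C -> size a <= n -> rej (restr C n) B -> ~ F (restr C n).
  move=> aC an rejC FC; apply: (rejC B HB (@le_at_refl _ _ B)).
  move=> C' [/initialE]; rewrite size_restr => E _; exists n; rewrite ?size_restr //.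
  by rewrite -E.
case: (pselect (acc a B)) => [|nacc]; [by left | right].
have rej_a C : basic a B C -> rej (restr C (size a)) B.
  move=> aC; have := QB C (size a) aC (leqnn _); rewrite restrC_a //.
  by case=> // -[].
suff rejB C n : basic a B C -> size a <= n -> rej (restr C n) B.
  by move=> C n aC an; apply: rej_no => //; exact: rejB.
move=> aC; elim: n => [|n IH]; rewrite leq_eqVlt => /orP [/eqP an|an] //.
- by rewrite -an; exact: rej_a.
- by rewrite -an; exact: rej_a.
- have [accC|[_ rejC]] := QB C n aC an.
    by case: (IH an B HB (@le_at_refl _ _ B)).
  by have := rejC C (basic_restr aC an); rewrite size_restr.
Qed.

(** The dichotomy is applied to the segments whose whole cylinder lies in [Y]; a member of [Y] has
    such a segment, and a longer one still qualifies. *)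
Lemma open_Ramsey Y :
  (forall C, Y C -> exists n, forall C', restr C' n = restr C n -> Y C') -> Ramsey H Y.
Proof.
move=> Yopen; apply/RamseyP => A HA a.
have [B [HB BA [BY|BY]]] :=
  Galvin [set b : fblock k | forall C, restr C (size b) = b -> Y C] a HA; exists B; split=> //.
  by left=> C /BY [n _]; apply; rewrite size_restr.
right; apply/disjoints_subset => C aC YC; have [n nP] := Yopen _ YC.
apply: (BY C (maxn n (size a)) aC (leq_maxr _ _)) => C' /=; rewrite size_restr => E.
by apply: nP; apply: restr_eq_leq E; exact: leq_maxl.
Qed.

(** After fusion, apply the dichotomy to the segments whose basic set lies in a single [Y t]. If [C]
    has no such segment, then for each [t] a long enough segment decides [Y t] negatively, so [C]
    avoids the union. *)
Lemma Ramsey_bigcup (T : countType) (Y : T -> set (iblock k)) :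
  (forall t, Ramsey H (Y t)) -> Ramsey H (\bigcup_t Y t).
Proof.
move=> RY; apply/RamseyP => A HA a.
have [B [HB BA BY]] := Ramsey_fusion RY a HA.
have [B' [HB' B'B dich]] := Galvin [set b : fblock k | exists t, basic b B `<=` Y t] a HB.
exists B'; split=> //; first exact: iblock_le_trans B'B BA.
case: dich => [cover|avoid]; [left | right].
  move=> C aC; have [n an [t tP]] := cover C aC; exists t => //.
  by apply: tP; apply: basic_le B'B _ _; exact: basic_restr aC an.
apply/disjoints_subset => C aC [t _ YC].
have aC' := basic_le B'B aC.
have an : size a <= maxn (size a) (choice.pickle t) := leq_maxl _ _.
have [sub|disj] := BY C _ t aC' an (leq_maxr _ _).
  by apply: (avoid C _ aC an); exists t.
by have /disjoints_subset/(_ C) := disj; apply => //; exact: basic_restr aC' an.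
Qed.

(** * The Suslin operation *)

Section Suslin.

Variable X : fblock k -> set (iblock k).
Hypothesis X_Ramsey : forall b, Ramsey H (X b).

Let S s : set (iblock k) :=
  [set C | exists2 A, restr A (size s) = s & forall n, X (restr A n) C].

Let child s u : Prop := exists p, fblock_val u = rcons s p.

Lemma suslin_child s C : S s C -> exists2 u, child s u & S u C.
Proof.
move=> [A As XA]; exists (restr A (size s).+1).
  exists (A (size s)); rewrite -{2}As /= /mkseq -addn1 iotaD map_cat cats1.
  by rewrite add0n.
by exists A; rewrite ?size_restr.
Qed.

Lemma suslin_sub s : S s `<=` X s.
Proof. by move=> C [A <- XA]; exact: XA. Qed.

Lemma branch_iblock (f : nat -> fblock k) :
  f 0 = nil :> seq _ -> (forall n, child (f n) (f n.+1)) ->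
  exists A, forall n, restr A n = f n.
Proof.
move=> f0 /choice [g gP].
have fE n : fblock_val (f n) = mkseq g n.
  elim: n => // n IH; rewrite gP IH /mkseq -[in RHS]addn1 iotaD map_cat cats1.
  by rewrite add0n.
have gb m n : m < n -> block_lt (g m) (g n).
  move=> mn; have /(pairwiseP (g 0)) : pairwise (@block_lt k) (f n.+1) by case: (f _).
  move=> /(_ m n); rewrite fE !inE size_mkseq !nth_mkseq ?ltnS ?(ltnW mn) //.
  by apply => //; rewrite ltnS ltnW.
by exists (MkIblock gb) => n; apply: val_inj; rewrite /= fE.
Qed.

Lemma suslin_Ramsey :
  Ramsey H (\bigcup_(A in [set: iblock k]) \bigcap_(n in [set: nat]) X (restr A n)).
Proof.
have -> : \bigcup_(A in [set: iblock k]) \bigcap_(n in [set: nat]) X (restr A n)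
    = S (MkFblock (isT : pairwise (@block_lt k) nil)).
  apply/seteqP; split=> [C [A _ XA]|C [A _ XA]]; exists A => //.
    exact: val_inj.
  by move=> n; exact: XA.
set root := MkFblock _.
apply/RamseyP => A HA a.
pose kills s b B := basic b B `&` S s = set0.
have kills_down s b B1 B2 : kills s b B1 -> le_at b B2 B1 -> kills s b B2.
  by move=> kB /basic_le_at B21; apply: subsetI_eq0 kB.
pose settled s b B := kills s b B \/ forall B', H B' -> le_at b B' B -> ~ kills s b B'.
have settled_down s b B1 B2 : settled s b B1 -> le_at b B2 B1 -> settled s b B2.
  move=> [kB|nk] B21; [left; exact: kills_down B21 | right=> B3 HB3 B32].
  by apply: nk => //; exact: le_at_trans B32 B21.
have [A1 [HA1 A1A decX]] := Ramsey_fusion X_Ramsey a HA.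
pose P b B := forall s, choice.pickle s < (size b).+1 -> settled s b B.
have [||B0 [HB0 B0A1 PB0]] := @fusion P _ _ a A1 HA1.
- by move=> b B1 B2 PB1 B21 s sb; apply: settled_down (PB1 _ sb) B21.
- move=> b B; apply: finite_density => [s B1 B2 B1s B21|s B1 HB1].
    by apply: settled_down B1s _; exact: iblock_le_at.
  case: (pselect (settled s b B1)) => [sB|nsB].
    by exists B1; split=> //; exact: iblock_le_refl.
  (* If [B1] does not settle [s], some [B2] in [H] kills it, but only in the sense of [le_at];
     passing to its tail gives a sequence that is [iblock_le] below [B1]. *)
  have [B2 [HB2 B21 kB2]] : exists B2, [/\ H B2, le_at b B2 B1 & kills s b B2].
    apply: contrapT => nB2; apply: nsB; right=> B2 HB2 B21 kB2.
    by apply: nB2; exists B2.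
  have [HT TB1] := coideal_le_at H_coideal HB2 B21.
  exists (tail (fblock_supp b) B2); split=> //; left; apply: kills_down kB2 _.
  by apply: iblock_le_at; exact: tail_le.
pose hull s : set (iblock k) := [set C | forall n,
  size a <= n -> choice.pickle s <= n -> ~ kills s (restr C n) B0].
have hull_Ramsey s : Ramsey H (hull s).
  rewrite -[hull s]setCK; apply: Ramsey_setC; apply: open_Ramsey => C.
  move=> /existsNP [n /not_implyP [an /not_implyP [sn /contrapT kC]]].
  by exists n => C' E; apply/existsNP; exists n; rewrite E => /(_ an sn).
have hull_sub s C : basic a B0 C -> S s C -> hull s C.
  move=> aC SC n an sn kC; suff : (basic (restr C n) B0 `&` S s) C by rewrite kC.
  by split=> //; exact: basic_restr aC an.
(* A long segment of [C] decides [X s]; the negative answer would kill [S s], which is contained in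
   [X s]. *)
have hull_X s C : basic a B0 C -> hull s C -> X s C.
  move=> aC hC; pose n := maxn (size a) (choice.pickle s).
  have an : size a <= n := leq_maxl _ _; have sn : choice.pickle s <= n := leq_maxr _ _.
  have := decX C n s (basic_le B0A1 aC) an sn.
  move=> /decided_le_at /(_ (iblock_le_at B0A1)) [|disj].
    by apply; exact: basic_restr aC an.
  case: (hC n an sn); apply: subsetI_eq0 disj => //; exact: suslin_sub.
pose gap s : set (iblock k) := hull s `\` \bigcup_(u in child s) hull u.
have gap_Ramsey s : Ramsey H (gap s).
  (* The complement of the gap is a countable union: the index [None] carries the complement of the
     hull of [s], the others the hulls of children, with the empty set at non-children. *)
  pose Y (o : option (fblock k)) : set (iblock k) :=
    if o is Some u then [set C | child s u /\ hull u C] else ~` hull s.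
  have -> : gap s = ~` (\bigcup_o Y o).
    apply/seteqP; split=> C.
      by move=> [hC nC] [[u|] _ //= [su uC]]; apply: nC; exists u.
    move=> nC; split; first by apply: contrapT => hC; apply: nC; exists None.
    by move=> [u su uC]; apply: nC; exists (Some u).
  apply: Ramsey_setC; apply: Ramsey_bigcup => -[u|]; last exact: Ramsey_setC.
  case: (pselect (child s u)) => su.
    have -> : Y (Some u) = hull u by apply/seteqP; split=> C // [].
    by [].
  have -> : Y (Some u) = set0 by apply/seteqP; split=> C // [].
  exact: Ramsey_set0.
have [B1 [HB1 B10 decG]] := Ramsey_fusion gap_Ramsey a HB0.
have no_gap s C : basic a B1 C -> ~ gap s C.
  move=> aC gC; have aC0 := basic_le B10 aC.
  pose n := maxn (size a) (choice.pickle s).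
  have an : size a <= n := leq_maxl _ _; have sn : choice.pickle s <= n := leq_maxr _ _.
  have nC := basic_restr aC an.
  have [sub|/disjoints_subset disj] := decG C n s aC an sn; last exact: disj nC gC.
  (* A basic set inside the gap misses [S s], as each point of [S s] lies in the hull of a child. So
     [B1] kills [s], hence by settledness [B0] already did, contradicting that [C] is in the
     hull. *)
  have kB1 : kills s (restr C n) B1.
    apply/disjoints_subset => D nD SD; have [_ []] := sub D nD.
    have aD : basic a B0 D by apply: basic_le B10 _ _; exact: sub_basic_restr nD.
    by have [u su uD] := suslin_child SD; exists u => //; exact: hull_sub.
  have [|kB0|nk] := PB0 C n aC0 an s; first by rewrite size_restr.
    by case: gC => hC _; exact: hC n an sn kB0.
  by case: (nk B1 HB1 (iblock_le_at B10)).
have /RamseyP/(_ B1 HB1 a) [B2 [HB2 B21 dec]] := hull_Ramsey root.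
have B20 := iblock_le_trans B21 B10.
exists B2; split=> //; first exact: iblock_le_trans B20 (iblock_le_trans B0A1 A1A).
case: dec => [sub|/disjoints_subset disj]; [left | right].
  move=> C aC; have aC0 := basic_le B20 aC.
  (* With no gaps, each [s] whose hull contains [C] has a child with the same property; iterating
     from the root yields the branch. Outside such [s] the choice is arbitrary. *)
  have /choice [g gP] : forall s, exists u, hull s C -> child s u /\ hull u C.
    move=> s; case: (pselect (hull s C)) => [hC|nh]; last by exists s.
    apply: contrapT => nu; apply: (no_gap s C (basic_le B21 aC)); split=> // -[u su uC].
    by apply: nu; exists u.
  have hC n : hull (iter n g root) C.
    by elim: n => [|n /gP [_ hC]] //; exact: sub.
  have [A' A'E] := @branch_iblock (fun n => iter n g root) erefl (fun n => (gP _ (hC n)).1).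
  exists A' => [|n]; first exact: A'E 0.
  rewrite A'E; exact: hull_X.
apply/disjoints_subset => C aC SC; apply: (disj C aC).
by apply: hull_sub SC; exact: basic_le B20 _ aC.
Qed.

End Suslin.

End Gowers.

End Semiselective.

End RamseyTheory.

Theorem corollary4 (k : nat) (hk : 1 <= k) (H : set (iblock k))
  (H_coideal : coideal H) (H_Gowers : Gowers H)
  (H_semiselective : semiselective H)
  (X : fblock k -> set (iblock k)) (X_Ramsey : forall a, Ramsey H (X a)) :
  Ramsey H
    (\bigcup_(A in [set: iblock k]) \bigcap_(n in [set: nat]) X (restr A n)).
Proof. exact: suslin_Ramsey. Qed.
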